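(* Let $1\le r<k$ and let $\mathcal{G}$ be a digraph with vertices $v_1,\dots,v_k$ and simple loops $s_1,\dots,s_p$ ($p\ge1$), such that from each $v_i$ with $i>r$ there is a path to some $v_j$ with $j\le r$, and from each $v_i$ with $i\le r$ there is a path to some $v_j$ with $j>r$. Let $\mathcal{G}_s,\mathcal{G}_u$ be the subgraphs of $\mathcal{G}$ with $\mathcal{E}(\mathcal{G}_s)=\{(i,j)\in\mathcal{E}(\mathcal{G}): i\le r\}$ and $\mathcal{E}(\mathcal{G}_u)=\{(i,j)\in\mathcal{E}(\mathcal{G}): i>r\}$. Let $A_1,\dots,A_k$ be real $d\times d$ matrices, diagonalizable over $\mathbb{C}$, with $A_1,\dots,A_r$ stable and $A_{r+1},\dots,A_k$ unstable. Let $-\lambda_i<0$ ($1\le i\le r$) and $\mu_j>0$ ($r+1\le j\le k$) be the maximum of the real parts of the eigenvalues of $A_i$ and $A_j$, respectively. For each $j$ fix $P_j$ with $A_j=P_jD_jP_j^{-1}$, where $D_j$ is the real Jordan form of $A_j$ and the columns of $P_j$ are eigenvectors of $A_j$ of unit norm. Let $\tau_1,\eta_1,\dots,\tau_p,\eta_p>0$ and let $\sigma$ be a $\mathcal{G}$-admissible signal with infinitely many switching times $t_1<t_2<\cdots$, $t_n\to\infty$, such that for every $T>0$ there exist $t,s>T$ with $\sigma(t)\in\{1,\dots,r\}$ and $\sigma(s)\in\{r+1,\dots,k\}$. Assume $\sigma\in\mathcal{S}_{\mathcal{G}}(\tau_1,\eta_1,\dots,\tau_p,\eta_p)$, i.e.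 for every $n\ge1$ and every $i\in\{1,\dots,p\}$, on each occurrence of $s_i$ in the standard decomposition of $\sigma^{(n)}=\sigma_1\cdots\sigma_n$ the signal spends total time at least $\tau_i$ on the stable vertices of $s_i$ and total time at most $\eta_i$ on the unstable vertices of $s_i$. If for all $i=1,\dots,p$ $$\ln\rho_i-\lambda_{s_i}\tau_i+\mu_{s_i}\eta_i<0,$$ where $$\rho_i=\prod_{(u,v)\in\mathcal{E}(s_i)}\Vert P_v^{-1}P_u\Vert,\qquad -\lambda_{s_i}=\max_{(u,v)\in\mathcal{E}(s_i)\cap\mathcal{E}(\mathcal{G}_s)}(-\lambda_u),\qquad \mu_{s_i}=\max_{(u,v)\in\mathcal{E}(s_i)\cap\mathcal{E}(\mathcal{G}_u)}\mu_u$$ (with $\lambda_{s_i}=0$, respectively $\mu_{s_i}=0$, if the corresponding index set is empty), then the switched system $x'(t)=A_{\sigma(t)}x(t)$, $t\ge0$, is asymptotically stable, i.e. $\lim_{t\to\infty}\Vert x(t)\Vert=0$ for every $x(0)\in\mathbb{R}^d$.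
   Context: A matrix is stable if all its eigenvalues have negative real part, and unstable if it has at least one eigenvalue with positive real part and no eigenvalue with zero real part. The vertices $v_1,\dots,v_r$ are called stable and $v_{r+1},\dots,v_k$ unstable. There is at most one edge from any vertex to another; $\mathcal{E}(\cdot)$ denotes the edge set of a graph or loop, as a set of pairs $(i,j)$ such that there is an edge from $v_i$ to $v_j$. A simple loop is a closed directed path whose vertices are all distinct (apart from the coincidence of its endpoints), regarded up to the choice of starting vertex. A $\mathcal{G}$-admissible signal is a right-continuous piecewise constant function $\sigma:[0,\infty)\to\{1,\dots,k\}$ with switching times (discontinuities) $t_1<t_2<\cdots$ and $t_0=0$, such that, writing $\sigma_n$ for the value of $\sigma$ on $[t_{n-1},t_n)$, one has $(\sigma_n,\sigma_{n+1})\in\mathcal{E}(\mathcal{G})$ for all $n\ge1$. $\Vert\cdot\Vert$ is the Euclidean norm of vectors and the spectral norm of matrices. In the real Jordan form $A_j=P_jD_jP_j^{-1}$, for a non-real conjugate pair of eigenvalues the two corresponding columns of $P_j$ are the real and imaginary parts of a complex eigenvector. Standard decomposition. Let $e_j=(\sigma_j,\sigma_{j+1})$ and associate to $e_j$ the time $\delta_j=t_j-t_{j-1}$ that the signal spends in subsystem $\sigma_j$ before switching to $\sigma_{j+1}$. The standard decomposition of $\sigma^{(n)}=\sigma_1\cdots\sigma_n$ is obtained as follows. Start with the path $P=(e_1,\dots,e_{n-1})$. Given the current path $P$ (a sequence of remaining edges $e_j$, in increasing order of index, forming a path), let $k_2$ be the smallest index of an edge of $P$ for which there is an edge $e_{k_1}$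 of $P$ with $k_1<k_2$ and $\sigma_{k_1}=\sigma_{k_2+1}$. If no such pair exists, $P$ is called indecomposable and the algorithm stops. Otherwise the edges of $P$ with indices between $k_1$ and $k_2$ (inclusive) form a simple loop in $\mathcal{G}$; delete them from $P$ and repeat with the remaining path. The total time spent on the stable (resp. unstable) vertices of such an occurrence of a simple loop is the sum of $\delta_j$ over its edges $e_j$ with $\sigma_j\in\{1,\dots,r\}$ (resp. $\sigma_j\in\{r+1,\dots,k\}$). *)

(* Defs.v *)
From mathcomp Require Export all_boot all_order all_algebra.
From mathcomp Require Export all_classical all_reals all_analysis.
From mathcomp Require Export complex.

Set Implicit Arguments.
Unset Strict Implicit.
Unset Printing Implicit Defensive.

Export Order.TTheory GRing.Theory Num.Theory.
Export numFieldNormedType.Exports.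

Local Open Scope classical_set_scope.
Local Open Scope complex_scope.
Local Open Scope ring_scope.

Section Matrices.
Variable R : realType.

Definition complex_mx m n (A : 'M[R]_(m, n)) : 'M[R[i]]_(m, n) :=
  map_mx (real_complex R) A.

(* MathComp's [eigenvalue] is about row vectors; the spectrum is the same. *)
Definition stable_mx d (A : 'M[R]_d) : Prop :=
  forall z : R[i], eigenvalue (complex_mx A) z -> complex.Re z < 0.

Definition unstable_mx d (A : 'M[R]_d) : Prop :=
  (exists2 z : R[i], eigenvalue (complex_mx A) z & 0 < complex.Re z) /\
  (forall z : R[i], eigenvalue (complex_mx A) z -> complex.Re z <> 0).

Definition max_real_part d (A : 'M[R]_d) (a : R) : Prop :=
  (exists2 z : R[i], eigenvalue (complex_mx A) z & complex.Re z = a) /\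
  (forall z : R[i], eigenvalue (complex_mx A) z -> complex.Re z <= a).

Definition euclid_norm n (v : 'cV[R]_n) : R :=
  Num.sqrt (\sum_i v i 0 ^+ 2).

Definition ceuclid_norm n (w : 'cV[R[i]]_n) : R :=
  Num.sqrt (\sum_i (complex.Re (w i 0) ^+ 2 + complex.Im (w i 0) ^+ 2)).

Definition spectral_norm m n (M : 'M[R]_(m, n)) : R :=
  sup [set euclid_norm (M *m v) | v in [set v : 'cV[R]_n | euclid_norm v <= 1]].

(* [real_jordan_basis A P D]: D is block diagonal, with a block (a) for a real
   eigenvalue a and a block [a, b; -b, a] for a non-real pair a +- ib (so D is
   a real Jordan form without nilpotent part), and the columns of P are the
   matching unit eigenvectors of A.  To a 2 x 2 block correspond the columns
   Re w and Im w, where w is an eigenvector for a + ib of unit norm in C^d.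
   The number m of columns grows with the blocks; P is square when m = d. *)
Inductive real_jordan_basis d (A : 'M[R]_d) :
    forall m, 'M[R]_(d, m) -> 'M[R]_m -> Prop :=
| RealJordanNil (P : 'M[R]_(d, 0)) (D : 'M[R]_0) : real_jordan_basis A P D
| RealJordanReal m (P : 'M[R]_(d, m)) (D : 'M[R]_m) (a : R) (v : 'cV[R]_d) of
    A *m v = a *: v & euclid_norm v = 1 & real_jordan_basis A P D :
    real_jordan_basis A (row_mx v P) (block_mx (a%:M : 'M[R]_1) 0 0 D)
| RealJordanPair m (P : 'M[R]_(d, m)) (D : 'M[R]_m) (a b : R)
    (w : 'cV[R[i]]_d) of
    b != 0 & complex_mx A *m w = (a +i* b) *: w & ceuclid_norm w = 1 &
    real_jordan_basis A P D :
    real_jordan_basis A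
      (row_mx (row_mx (map_mx (@complex.Re R) w) (map_mx (@complex.Im R) w)) P)
      (block_mx (block_mx (a%:M : 'M[R]_1) b%:M (- b)%:M (a%:M : 'M[R]_1)) 0 0 D).

End Matrices.

Section Graphs.
Variable k : nat.
Implicit Types (G : rel 'I_k) (c : seq 'I_k).

Definition edges G : {set 'I_k * 'I_k} := [set e | G e.1 e.2].

(* The vertices are numbered from 0: the stable ones are those below r. *)
Definition is_stable r (v : 'I_k) : bool := (v < r)%N.

Definition stable_subgraph r G : rel 'I_k := fun u v => G u v && is_stable r u.
Definition unstable_subgraph r G : rel 'I_k :=
  fun u v => G u v && ~~ is_stable r u.

(* A simple loop is given by its vertices from some starting point; [same_loop]
   identifies the choices of that point. *)
Definition simple_loop G c : bool := [&& c != [::], cycle G c & uniq c].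
Definition same_loop c c' : Prop := exists n, c = rot n c'.

Definition loop_edges c : {set 'I_k * 'I_k} := [set (u, next c u) | u in c].

Definition enumerates_simple_loops G p (s : 'I_p -> seq 'I_k) : Prop :=
  (forall i, simple_loop G (s i)) /\
  (forall c, simple_loop G c -> exists! i, same_loop c (s i)).

End Graphs.

Definition max_or0 (R : realType) (l : seq R) : R :=
  if l is x :: l' then \big[Num.max/x]_(y <- l') y else 0.

Section LoopData.
Variables (R : realType) (k d r : nat) (G : rel 'I_k).

Definition rho (P : 'I_k -> 'M[R]_d) (c : seq 'I_k) : R :=
  \prod_(e in loop_edges c) spectral_norm (invmx (P e.2) *m P e.1).

Definition lambda_loop (lam : 'I_k -> R) (c : seq 'I_k) : R :=
  - max_or0
      [seq - lam e.1 | e in loop_edges c :&: edges (stable_subgraph r G)].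

Definition mu_loop (mu : 'I_k -> R) (c : seq 'I_k) : R :=
  max_or0 [seq mu e.1 | e in loop_edges c :&: edges (unstable_subgraph r G)].

End LoopData.

(* Signals are functions on R of which only the values on [0, +oo) matter. *)
Section Signals.
Variables (R : realType) (k : nat).
Implicit Types (sigma : R -> 'I_k) (t : nat -> R).

(* t_0 = 0, and t_1 < t_2 < ... -> +oo are the discontinuities of sigma, which
   is constant on each [t_n, t_{n+1}). *)
Definition switching_times sigma t : Prop :=
  [/\ t 0%N = 0,
      (forall n, t n < t n.+1),
      t @ \oo --> +oo,
      (forall n x, t n <= x < t n.+1 -> sigma x = sigma (t n)) &
      (forall n, sigma (t n.+1) <> sigma (t n))].

(* sigma_n, the value on [t_{n-1}, t_n), and delta_n = t_n - t_{n-1}; n >= 1. *)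
Definition symbol sigma t (n : nat) : 'I_k := sigma (t n.-1).
Definition dwell t (n : nat) : R := t n - t n.-1.

Definition admissible (G : rel 'I_k) sigma t : Prop :=
  forall n, (1 <= n)%N -> G (symbol sigma t n) (symbol sigma t n.+1).

End Signals.

(* In a path, the edge e_j = (w j, w j.+1) is represented by its index j. *)
Section StandardDecomposition.
Variables (k : nat) (w : nat -> 'I_k).
Implicit Types (P L : seq nat).

Definition closing P k1 k2 : Prop :=
  [/\ k1 \in P, k2 \in P, (k1 < k2)%N & w k1 = w k2.+1].

Definition first_closing P k1 k2 : Prop :=
  closing P k1 k2 /\ (forall j1 j2, closing P j1 j2 -> (k2 <= j2)%N).

(* [removed_loop P L]: L is one of the loop occurrences deleted when the
   algorithm is run from the path P. *)
Inductive removed_loop : seq nat -> seq nat -> Prop :=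
| RemovedNow P k1 k2 of first_closing P k1 k2 :
    removed_loop P [seq j <- P | (k1 <= j <= k2)%N]
| RemovedLater P L k1 k2 of first_closing P k1 k2 &
    removed_loop [seq j <- P | ~~ (k1 <= j <= k2)%N] L :
    removed_loop P L.

(* The word w 1, ..., w n has the edges e_1, ..., e_{n-1}. *)
Definition decomposition_loop (n : nat) L : Prop := removed_loop (iota 1 n.-1) L.

End StandardDecomposition.

Section SwitchedSystem.
Variables (R : realType) (k d : nat).

Definition dwell_class r p (s : 'I_p -> seq 'I_k) (tau eta : 'I_p -> R)
    (sigma : R -> 'I_k) (t : nat -> R) : Prop :=
  let w := symbol sigma t in
  forall (n : nat) (i : 'I_p) (L : seq nat), (1 <= n)%N ->
    decomposition_loop w n L -> same_loop [seq w j | j <- L] (s i) ->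
    tau i <= \sum_(j <- L | is_stable r (w j)) dwell t j /\
    \sum_(j <- L | ~~ is_stable r (w j)) dwell t j <= eta i.

(* x is continuous on [0, +oo) and satisfies the equation at every t > 0 which
   is not a switching time. *)
Definition solution (A : 'I_k -> 'M[R]_d) (sigma : R -> 'I_k)
    (x : R -> 'cV[R]_d) : Prop :=
  {within `[0, +oo[, continuous x} /\
  (forall t : R, 0 < t -> (\forall u \near t, sigma u = sigma t) ->
    is_derive t (1 : R) x (A (sigma t) *m x t)).

Definition asymptotically_stable (A : 'I_k -> 'M[R]_d) (sigma : R -> 'I_k) :
    Prop :=
  forall (x0 : 'cV[R]_d) (x : R -> 'cV[R]_d),
    x 0 = x0 -> solution A sigma x ->
    euclid_norm (x t) @[t --> +oo] --> (0 : R).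

End SwitchedSystem.

(* Main.v *)
Require Import Defs.
From mathcomp Require Import ring lra.
Local Open Scope classical_set_scope.
Local Open Scope ring_scope.

Set Implicit Arguments.
Unset Strict Implicit.

(* In the coordinates P_v^-1 x the flow of A_v grows at most like e^(a_v t),
   where a_v is the largest real part of an eigenvalue, because the quadratic
   form of the real Jordan form D_v is bounded by a_v |y|^2.  Hence |x(t)| is at
   most a constant times the product of the gains
   |P_v^-1 P_u| e^(a_u delta) over the edges travelled so far, and by hypothesis
   the gain of every loop of the standard decomposition is at most some Q < 1.
   At most k edges are outside the loops, and their gains are bounded: only
   finitely many edges never enter a loop, so the dwell times in the unstable
   subsystems are bounded.  As a loop has at most k edges, the product of the
   first n gains is O(c^n) for some c < 1. *)

(** * Sequences: sorted paths, cyclic successors, cutting at a first hit *)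

Lemma sorted_rcons2 (T : Type) (e : rel T) (s : seq T) x y :
  sorted e (rcons (rcons s x) y) = sorted e (rcons s x) && e x y.
Proof. by case: s => [|z s] /=; rewrite ?andbT // rcons_path last_rcons. Qed.

Lemma sorted_rcons_change (T : Type) (e : rel T) (s : seq T) x y :
  (forall z, e z x -> e z y) -> sorted e (rcons s x) -> sorted e (rcons s y).
Proof.
by move=> exy; case/lastP: s => [//|s z]; rewrite !sorted_rcons2 => /andP[-> /exy].
Qed.

Lemma map_next (T : eqType) (x : T) (p : seq T) :
  uniq (x :: p) -> [seq next (x :: p) y | y <- x :: p] = rcons p x.
Proof.
move=> u; apply: (@eq_from_nth _ x); first by rewrite size_map size_rcons.
rewrite size_map => i ip; rewrite (nth_map x) // next_nth mem_nth //.
rewrite index_uniq // nth_rcons.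
move: ip; rewrite /= ltnS leq_eqVlt => /orP[/eqP ->|-> //].
by rewrite ltnn eqxx nth_default.
Qed.

Variant cut_at_first_spec (T : Type) (a : pred T) :
    seq T -> seq T -> seq T -> Prop :=
| CutFound s1 x s2 of a x & ~~ has a s1 :
    cut_at_first_spec a (s1 ++ x :: s2) s1 (x :: s2)
| CutNotFound s of ~~ has a s : cut_at_first_spec a s s [::].

Lemma cut_at_firstP (T : Type) (a : pred T) (s : seq T) :
  cut_at_first_spec a s (take (find a s) s) (drop (find a s) s).
Proof.
elim: s => [|x s IH] /=; first exact: CutNotFound.
case: ifPn => ax /=; first exact: (@CutFound _ a [::]).
case: IH => [s1 y s2 ay ns1|s' ns'].
  by apply: (@CutFound _ a (x :: s1)) => //=; rewrite negb_or ax.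
by apply: CutNotFound; rewrite /= negb_or ax.
Qed.

Lemma uniq_map_inj (T1 T2 : eqType) (f : T1 -> T2) (s : seq T1) :
  uniq [seq f x | x <- s] -> {in s &, injective f}.
Proof.
elim: s => [//|z s IH] /= /andP[fz /IH inj] x y; rewrite !inE.
move=> /orP[/eqP ->|xs] /orP[/eqP ->|ys] // e; last exact: inj.
- by case/negP: fz; rewrite e map_f.
- by case/negP: fz; rewrite -e map_f.
Qed.

(** * The standard decomposition, computed by reading one edge at a time *)

Section LoopErasure.
Variables (k : nat) (w : nat -> 'I_k).
Hypothesis w_switch : forall j, w j.+2 != w j.+1.
Local Open Scope nat_scope.

(* [remaining m] is the path left by the algorithm on e_1, ..., e_m, and
   [closed_loop m] the loop (if any) that the edge e_(m+1) closes. *)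
Fixpoint remaining (m : nat) : seq nat :=
  if m is m'.+1 then
    let V := rcons (remaining m') m in take (find (fun j => w j == w m.+1) V) V
  else [::].

Definition closed_loop (m : nat) : seq nat :=
  let V := rcons (remaining m) m.+1 in
  drop (find (fun j => w j == w m.+2) V) V.

Lemma remaining_closed_loop m :
  remaining m.+1 ++ closed_loop m = rcons (remaining m) m.+1.
Proof. by rewrite /closed_loop /= cat_take_drop. Qed.

(** Deletions leave gaps between the indices, so neighbours in a remaining path need not be [j] and
    [j.+1]; only the vertices have to match. *)
Definition follows (i j : nat) := (i < j) && (w i.+1 == w j).

(** Cutting just before the first edge that leaves [w m.+2] frees this vertex for the next edge. The
    edge before the cut ended there too, so the next edge still continues the path. *)
Lemma remaining_inv m (V := rcons (remaining m) m.+1) :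
  [/\ sorted follows V, uniq [seq w j | j <- V] &
      all (fun j => 0 < j <= m.+1) V].
Proof.
rewrite {}/V; elim: m => [//|m [sV uV bV]].
have sV' : sorted follows (rcons (rcons (remaining m) m.+1) m.+2).
  by rewrite sorted_rcons2 sV /follows ltnS leqnn eqxx.
rewrite [remaining m.+1]/=; move: (rcons (remaining m) _) sV uV bV sV' => V.
case: cut_at_firstP => [s1 x s2 /eqP wx ns1|s ns] sV uV bV sV'; last first.
  split=> //; last first.
    rewrite all_rcons /= leqnn; apply: sub_all bV => j /andP[-> h].
    exact: leq_trans h _.
  rewrite map_rcons rcons_uniq uV andbT; apply/negP => /mapP[j js e].
  by case/negP: ns; apply/hasP; exists j => //; rewrite e.
move: bV; rewrite all_cat /= => /and3P[b1 /andP[x0 xm] _].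
split.
- move: sV; rewrite sorted_cat_cons => /andP[+ _]; apply: sorted_rcons_change.
  by move=> z; rewrite /follows wx => /andP[zx ->]; rewrite (leq_trans zx) ?(leq_trans xm).
- move: uV; rewrite map_cat cat_uniq map_rcons rcons_uniq => /and3P[-> _ _].
  rewrite andbT; apply/negP => /mapP[j js e].
  by case/negP: ns1; apply/hasP; exists j => //; rewrite e.
- rewrite all_rcons /= leqnn; apply: sub_all b1 => j /andP[-> h].
  exact: leq_trans h _.
Qed.

Lemma uniq_remaining m : uniq [seq w j | j <- remaining m].
Proof. by have [_] := remaining_inv m; rewrite map_rcons rcons_uniq => /andP[]. Qed.

Lemma size_remaining m : size (remaining m) <= k.
Proof.
rewrite -(size_map w) -(card_uniqP (uniq_remaining m)) -[leqRHS]card_ord.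
exact: max_card.
Qed.

(** Once e_(m+1) is appended, the edge after [j2] starts at [w j2.+1]; an equality would thus be a
    repetition among the distinct source vertices. *)
Lemma remaining_indecomposable m j1 j2 :
  j1 \in remaining m -> j2 \in remaining m -> j1 < j2 -> w j1 != w j2.+1.
Proof.
move=> j1S j2S lt; have [sV uV _] := remaining_inv m.
case/splitPr: j2S j1S sV uV => s1 s2 j1S.
rewrite rcons_cat rcons_cons; case e: (rcons s2 _) => [|j3 s3].
  by move/(congr1 size): e; rewrite size_rcons.
rewrite sorted_cat_cons /= => /and3P[_ /andP[l23 /eqP ->] _] u.
apply/negP => /eqP w13.
have j1V : j1 \in s1 ++ j2 :: j3 :: s3.
  by rewrite -e -rcons_cons -rcons_cat mem_rcons inE j1S orbT.
have j3V : j3 \in s1 ++ j2 :: j3 :: s3 by rewrite mem_cat !inE eqxx !orbT.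
have := ltn_trans lt l23.
by rewrite (uniq_map_inj u j1V j3V w13) ltnn.
Qed.

(** One step of the algorithm, with [s] the edges not yet read. The path before e_(m+1) is
    indecomposable, so no closing pair ends earlier, and the cut of [remaining] agrees with the
    deletion by index range. *)
Lemma first_closing_remaining m s : closed_loop m != [::] ->
  let P := rcons (remaining m) m.+1 ++ s in
  all (fun j => m.+1 < j) s ->
  exists k1, [/\ first_closing w P k1 m.+1,
    [seq j <- P | k1 <= j <= m.+1] = closed_loop m &
    [seq j <- P | ~~ (k1 <= j <= m.+1)] = remaining m.+1 ++ s].
Proof.
move=> + P bs.
have [sV uV bV] := remaining_inv m.
have indec := @remaining_indecomposable m.
have ltP : pairwise ltn (rcons (remaining m) m.+1).
  rewrite -sorted_pairwise; last exact: ltn_trans.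
  by apply: sub_sorted sV => i j /andP[].
have mV : m.+1 \in rcons (remaining m) m.+1 by rewrite mem_rcons inE eqxx.
have inV j : j \in rcons (remaining m) m.+1 -> j < m.+1 -> j \in remaining m.
  by rewrite mem_rcons inE => /orP[/eqP ->|//]; rewrite ltnn.
rewrite /P /closed_loop [remaining m.+1]/=; move: bV ltP mV inV {sV uV P}.
have := w_switch m; move: (rcons _ _) => V.
case: cut_at_firstP => [s1 x s2 /eqP wx ns1|//] wm.
rewrite all_cat pairwise_cat /= => /and3P[b1 /andP[_ xm] b2].
rewrite allrel_consr => /and4P[/andP[s1x _] _ xs2 _] mV inV _.
(* The closing pair needs k1 < k2 strictly; consecutive symbols differ, so e_(m+1) does not close on
   itself. *)
have {}xm : x < m.+1.
  rewrite ltn_neqAle xm andbT; apply/negP => /eqP xm'.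
  by move: wm; rewrite -wx xm' eqxx.
have eT : {in x :: s2, forall j, (x <= j <= m.+1)}.
  move=> j; rewrite inE => /orP[/eqP ->|js]; first by rewrite leqnn ltnW.
  have /andP[_ ->] := allP b2 _ js; rewrite andbT; exact/ltnW/(allP xs2 _ js).
have eF1 : {in s1, forall j, (x <= j <= m.+1) = false}.
  by move=> j js; have /= jx := allP s1x _ js; rewrite leqNgt jx.
have eF2 : {in s, forall j, (x <= j <= m.+1) = false}.
  by move=> j js; have /= mj := allP bs _ js; rewrite andbC leqNgt mj.
exists x; split.
- split; first by split=> //; rewrite mem_cat ?mV // mem_cat mem_head orbT.
  move=> j1 j2 [j1P j2P lt12 e12]; rewrite leqNgt; apply/negP => lt2.
  have lt1 := ltn_trans lt12 lt2.
  have memV j : j \in (s1 ++ x :: s2) ++ s -> j < m.+1 -> j \in remaining m.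
    rewrite mem_cat => /orP[jV|js]; first exact: inV.
    by have /= mj := allP bs _ js; rewrite ltnNge ltnW.
  by have := indec _ _ (memV _ j1P lt1) (memV _ j2P lt2) lt12; rewrite e12 eqxx.
- rewrite !filter_cat (eq_in_filter eF1) (eq_in_filter eF2) !filter_pred0 cats0.
  by rewrite (@eq_in_filter _ _ predT _ eT) filter_predT.
- rewrite !filter_cat.
  rewrite (@eq_in_filter _ _ predT s1) ?filter_predT => [|j /eF1 -> //].
  rewrite (@eq_in_filter _ _ predT s) ?filter_predT => [|j /eF2 -> //].
  rewrite (@eq_in_filter _ _ pred0 (x :: s2)) ?filter_pred0 => [|j /eT -> //].
  by rewrite cats0.
Qed.

(** After m edges are read, the algorithm is at [remaining m] followed by the unread edges. Going
    back from m to 0 restores one deletion at each index that closed a loop and changes nothing at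
    the others. *)
Lemma removed_loop_remaining L m n : m <= n ->
  removed_loop w (remaining m ++ iota m.+1 (n - m)) L ->
  removed_loop w (iota 1 n) L.
Proof.
elim: m => [|m IH] mn; first by rewrite subn0.
move=> rL; apply: IH; first exact: ltnW.
rewrite -(subnSK mn) /= -cat_rcons; have eV := remaining_closed_loop m.
have [nL|nL] := eqVneq (closed_loop m) [::]; first by rewrite -eV nL cats0.
have bs : all (fun j => m.+1 < j) (iota m.+2 (n - m.+1)).
  by apply/allP => j; rewrite mem_iota => /andP[].
have [k1 [cl _ e]] := first_closing_remaining nL bs.
by apply: RemovedLater cl _; rewrite e.
Qed.

(** The word of length m+2 ends with the edge e_(m+1), which closes the loop. One such length
    suffices, since [dwell_class] ranges over all n. *)
Lemma decomposition_closed_loop m : closed_loop m != [::] ->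
  decomposition_loop w m.+2 (closed_loop m).
Proof.
move=> nL; rewrite /decomposition_loop /=.
apply: (@removed_loop_remaining _ m m.+1) => //.
rewrite subSnn /= cats1.
have [k1 []] := first_closing_remaining nL (isT : all (fun j => m.+1 < j) [::]).
by rewrite !cats0 => f <- _; apply: RemovedNow.
Qed.

End LoopErasure.

(** * Deleted loops, and the edges that survive *)

Section ClosedLoops.
Variables (k : nat) (w : nat -> 'I_k).
Local Open Scope nat_scope.

Lemma closed_loop_gt0 m j : j \in closed_loop w m -> 0 < j.
Proof.
have [_ _ b] := remaining_inv w m.
by move=> jL; have /andP[] := allP b j (mem_drop jL).
Qed.

Lemma uniq_closed_loop m : uniq [seq w j | j <- closed_loop w m].
Proof.
by have [_ u _] := remaining_inv w m; rewrite map_drop drop_uniq.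
Qed.

Lemma next_closed_loop m :
  {in closed_loop w m, forall j, next [seq w j | j <- closed_loop w m] (w j) = w j.+1}.
Proof.
have uL := uniq_closed_loop m; move: (uL); rewrite /closed_loop.
have [sV _ _] := remaining_inv w m.
(* The index m+2 is appended to record where the last edge ends: at [w m.+2], the first vertex of
   the loop, which is also the cyclic successor of the last one. *)
have sV' : sorted (follows w) (rcons (rcons (remaining w m) m.+1) m.+2).
  by rewrite sorted_rcons2 sV /follows ltnS leqnn eqxx.
move: sV'; case: cut_at_firstP => [s1 x s2 /eqP wx _|//].
rewrite rcons_cat rcons_cons sorted_cat_cons => /andP[_ pV] u.
have := map_next u; rewrite -(map_comp _ w (x :: s2)) => e.
apply/eq_in_map; rewrite [LHS]e wx -map_rcons.
elim: s2 x pV {u wx e} => [|y s2 IH] x /=; first by rewrite andbT => /andP[_ /eqP ->].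
by move=> /andP[/andP[_ /eqP ->] /IH ->].
Qed.

Lemma closed_loop_simple (G : rel 'I_k) m : (forall j, G (w j.+1) (w j.+2)) ->
  closed_loop w m != [::] -> simple_loop G [seq w j | j <- closed_loop w m].
Proof.
move=> GE nL; rewrite /simple_loop uniq_closed_loop andbT; apply/andP; split.
  by move: nL; case: closed_loop.
set c := map _ _; have cn : cycle (frel (next c)) c := cycle_next (uniq_closed_loop m).
apply: (@sub_in_cycle _ (mem c)) cn; last exact/allP.
move=> u v uc _ /eqP <-; case/mapP: uc => j jL ->; rewrite next_closed_loop //.
by case: j jL => [/closed_loop_gt0|j].
Qed.

Lemma mem_remaining_or_closed j m : 0 < j <= m ->
  j \in remaining w m \/ exists i, j \in closed_loop w i.
Proof.
elim: m => [|m IH]; first by case: j.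
move=> jm; have : j \in rcons (remaining w m) m.+1 \/ exists i, j \in closed_loop w i.
  have [->|jm'] := eqVneq j m.+1; first by left; rewrite mem_rcons mem_head.
  case: IH => [|jr|]; first by case/andP: jm => ->; rewrite leq_eqVlt (negPf jm').
    by left; rewrite mem_rcons inE jr orbT.
  by right.
case; last by right.
rewrite -remaining_closed_loop mem_cat => /orP[]; first by left.
by right; exists m.
Qed.

(** An edge that is in no closed loop stays in [remaining m] for all later m. This path never has
    more than k edges, so k+1 such edges cannot exist. *)
Lemma eventually_closed : exists N, forall j, N < j -> exists m, j \in closed_loop w m.
Proof.
pose F := [set j | 0 < j /\ forall m, j \notin closed_loop w m]%classic.
have finF : finite_set F.
  apply: contrapT => infF; have [B BF kB] := infinite_set_fset k.+1 infF.
  set m := \max_(j <- finmap.enum_fset B) j.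
  have : {subset finmap.enum_fset B <= remaining w m}.
    move=> j jB; have [j0 jn] := BF j jB.
    have jm : j <= m by apply: (@leq_bigmax_seq _ _ predT id).
    case: (@mem_remaining_or_closed j m); rewrite ?j0 //; case=> i.
    by rewrite (negPf (jn i)).
  move/(uniq_leq_size (finmap.fset_uniq _)); rewrite leqNgt => /negP[].
  exact: leq_ltn_trans (size_remaining w m) kB.
have [N FN] : exists N, forall j, F j -> j <= N.
  case/finite_fsetP: finF => B ->; exists (\max_(j <- finmap.enum_fset B) j) => j jB.
  exact: (@leq_bigmax_seq _ _ predT id).
exists N => j Nj; apply: contrapT => nj.
suff /FN : F j by rewrite leqNgt Nj.
split=> [|m]; first exact: leq_trans Nj.
by apply/negP => jm; apply: nj; exists m.
Qed.

Local Open Scope ring_scope.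

(** Deleting a loop drops a factor at most 1, so the full product is at most the product over the
    remaining path. That path has at most k factors, and 1 <= K allows padding to exactly k. *)
Lemma prod_le_expr (R : realDomainType) (K : R) (h : nat -> R) : 1 <= K ->
  (forall j, 0 <= h j <= K) ->
  (forall m, \prod_(j <- closed_loop w m) h j <= 1) ->
  forall m, \prod_(1 <= j < m.+1) h j <= K ^+ k.
Proof.
move=> K1 hK hL m.
have K0 := le_trans ler01 K1.
have h0 j : 0 <= h j by have /andP[] := hK j.
suff : \prod_(1 <= j < m.+1) h j <= \prod_(j <- remaining w m) h j.
  move/le_trans; apply; apply: (@le_trans _ _ (K ^+ size (remaining w m))).
    elim: (remaining w m) => [|j s IH]; first by rewrite big_nil.
    rewrite big_cons exprS; apply: ler_pM => //; first exact: prodr_ge0.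
    by have /andP[] := hK j.
  by apply: ler_weXn2l; last exact: size_remaining.
elim: m => [|m IH]; first by rewrite big_geq // big_nil.
rewrite big_nat_recr //; set S := remaining w m.+1.
apply: (@le_trans _ _ (\prod_(j <- rcons (remaining w m) m.+1) h j)).
  by rewrite -cats1 big_cat big_seq1 /= ler_wpM2r.
rewrite -remaining_closed_loop big_cat /=.
by apply: ler_piMr => //; exact: prodr_ge0.
Qed.

End ClosedLoops.

(** * Euclidean and spectral norms; the quadratic form of a real Jordan form *)

Section Norms.
Local Open Scope complex_scope.
Variable R : realType.

Lemma euclid_norm_ge0 n (v : 'cV[R]_n) : 0 <= euclid_norm v.
Proof. exact: sqrtr_ge0. Qed.

Lemma sqr_euclid_norm n (v : 'cV[R]_n) : euclid_norm v ^+ 2 = (v^T *m v) 0 0.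
Proof.
rewrite sqr_sqrtr; last by apply: sumr_ge0 => i _; exact: sqr_ge0.
by rewrite mxE; apply: eq_bigr => i _; rewrite mxE expr2.
Qed.

Lemma dot_ge0 n (v : 'cV[R]_n) : 0 <= (v^T *m v) 0 0.
Proof. by rewrite -sqr_euclid_norm sqr_ge0. Qed.

Lemma euclid_norm0 n : euclid_norm (0 : 'cV[R]_n) = 0.
Proof.
rewrite /euclid_norm big1 ?sqrtr0 // => i _; by rewrite mxE expr0n.
Qed.

Lemma euclid_norm_eq0 n (v : 'cV[R]_n) : euclid_norm v = 0 -> v = 0.
Proof.
move=> v0; have : \sum_i v i 0 ^+ 2 = 0.
  transitivity (euclid_norm v ^+ 2); last by rewrite v0 expr0n.
  rewrite sqr_euclid_norm mxE.
  by apply: eq_bigr => i _; rewrite mxE expr2.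
move/eqP; rewrite psumr_eq0 => [/allP z|i _]; last exact: sqr_ge0.
apply/matrixP => i j; rewrite ord1 mxE; apply/eqP.
by have := z i (mem_index_enum i); rewrite sqrf_eq0.
Qed.

Lemma euclid_normZ n a (v : 'cV[R]_n) : euclid_norm (a *: v) = `|a| * euclid_norm v.
Proof.
apply/eqP; rewrite -(@eqrXn2 _ 2) ?mulr_ge0 ?euclid_norm_ge0 //.
rewrite exprMn !sqr_euclid_norm real_normK ?num_real // !mxE mulr_sumr.
by apply/eqP; apply: eq_bigr => i _; rewrite !mxE; ring.
Qed.

Lemma euclid_norm_le_sum n (v : 'cV[R]_n) : euclid_norm v <= \sum_i `|v i 0|.
Proof.
have s0 (s : seq 'I_n) : 0 <= \sum_(i <- s) `|v i 0| by exact: sumr_ge0.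
rewrite -(@ler_pXn2r _ 2) ?nnegrE ?euclid_norm_ge0 ?s0 // sqr_sqrtr; last first.
  by apply: sumr_ge0 => i _; exact: sqr_ge0.
elim: (index_enum _) => [|i s IH]; first by rewrite !big_nil expr0n.
rewrite !big_cons sqrrD -addrA real_normK ?num_real // lerD2l.
by apply: le_trans IH _; rewrite lerDr mulrn_wge0 // mulr_ge0.
Qed.

Lemma coord_le_euclid_norm n (v : 'cV[R]_n) i : `|v i 0| <= euclid_norm v.
Proof.
rewrite -sqrtr_sqr ler_sqrt; last by apply: sumr_ge0 => j _; exact: sqr_ge0.
by rewrite (bigD1 i) //= lerDl; apply: sumr_ge0 => j _; exact: sqr_ge0.
Qed.

(** Boundedness is what makes the [sup] in [spectral_norm] an actual upper bound; coordinates of a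
    vector in the unit ball are at most 1 in absolute value. *)
Lemma spectral_norm_has_ubound m n (M : 'M[R]_(m, n)) :
  has_ubound [set euclid_norm (M *m v) | v in [set v : 'cV[R]_n | euclid_norm v <= 1]].
Proof.
exists (\sum_i \sum_j `|M i j|) => _ [v v1 <-].
apply: le_trans (euclid_norm_le_sum _) _; apply: ler_sum => i _.
rewrite mxE; apply: le_trans (ler_norm_sum _ _ _) _; apply: ler_sum => j _.
by rewrite normrM ler_piMr // (le_trans (coord_le_euclid_norm v j)).
Qed.

Lemma spectral_norm_ge0 m n (M : 'M[R]_(m, n)) : 0 <= spectral_norm M.
Proof.
apply: ub_le_sup; first exact: spectral_norm_has_ubound.
by exists 0; rewrite /= ?mulmx0 euclid_norm0.
Qed.

Lemma euclid_norm_mulmx m n (M : 'M[R]_(m, n)) v :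
  euclid_norm (M *m v) <= spectral_norm M * euclid_norm v.
Proof.
have [v0|v0] := eqVneq (euclid_norm v) 0.
  by rewrite v0 (euclid_norm_eq0 v0) mulmx0 euclid_norm0 mulr0.
have vp : 0 < euclid_norm v by rewrite lt0r v0 euclid_norm_ge0.
rewrite -ler_pdivrMr //; apply: ub_le_sup; first exact: spectral_norm_has_ubound.
exists ((euclid_norm v)^-1 *: v).
  by rewrite /= euclid_normZ ger0_norm ?invr_ge0 ?euclid_norm_ge0 // mulVf ?lexx.
by rewrite -scalemxAr euclid_normZ ger0_norm ?invr_ge0 ?euclid_norm_ge0 // mulrC.
Qed.

(** Bridges the row convention of [eigenvalue] and the column eigenvectors of the Jordan basis: if
    [A - z%:M] were invertible, w would vanish. *)
Lemma eigenvalue_col n (F : fieldType) (A : 'M[F]_n) (w : 'cV[F]_n) z :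
  A *m w = z *: w -> w != 0 -> eigenvalue A z.
Proof.
move=> Aw w0; change (kermx (A - z%:M) != 0).
rewrite kermx_eq0 row_free_unit; apply/negP => uA.
case/eqP: w0; rewrite -[w](mulKmx uA) mulmxBl Aw mul_scalar_mx subrr.
by rewrite mulmx0.
Qed.

(** Induction on the blocks. In a 2 x 2 block the entries b and -b cancel in the quadratic form,
    leaving c |u|^2; and c <= a because the unit column attached to the block is a nonzero
    eigenvector. *)
Lemma jordan_form_le d (A : 'M[R]_d) m (P : 'M[R]_(d, m)) (D : 'M[R]_m) (a : R) :
  real_jordan_basis A P D ->
  (forall z : R[i], eigenvalue (complex_mx A) z -> complex.Re z <= a) ->
  forall y : 'cV[R]_m, (y^T *m (D *m y)) 0 0 <= a * (y^T *m y) 0 0.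
Proof.
move=> JB Aa; elim: JB => {m P D}
  [P D y|m P D c v Av v1 _ IH y|m P D c b w b0 Aw w1 _ IH y].
- by rewrite !mxE !big_ord0 mulr0.
- have ca : c <= a.
    apply: (Aa c%:C); apply: (@eigenvalue_col _ _ _ (map_mx (real_complex R) v)).
      by rewrite -map_mxM Av map_mxZ.
    rewrite map_mx_eq0; apply: contra_eq_neq v1 => ->.
    by rewrite euclid_norm0 eq_sym oner_neq0.
  rewrite -[y]vsubmxK; move: (usubmx y) (dsubmx y) => u z.
  rewrite mul_block_col !mul0mx addr0 add0r tr_col_mx !mul_row_col.
  rewrite mul_scalar_mx -scalemxAr [leLHS]mxE [X in X + _]mxE [in leRHS]mxE mulrDr.
  by rewrite lerD // ler_wpM2r ?dot_ge0.
- have ca : c <= a.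
    apply: (Aa (c +i* b)); apply: eigenvalue_col Aw _.
    apply: contra_eq_neq w1 => ->; rewrite /ceuclid_norm big1 ?sqrtr0.
      by rewrite eq_sym oner_neq0.
    by move=> i _; rewrite mxE /= expr0n addr0.
  rewrite -[y]vsubmxK; move: (usubmx y) (dsubmx y) => u z.
  rewrite mul_block_col !mul0mx addr0 add0r tr_col_mx !mul_row_col.
  rewrite [leLHS]mxE [in leRHS]mxE mulrDr lerD //.
  rewrite (_ : (_ *m (_ *m u)) 0 0 = c * (u^T *m u) 0 0); last first.
    rewrite -[u]vsubmxK; move: (usubmx u) (dsubmx u) => u1 u2.
    rewrite mul_block_col tr_col_mx !mul_row_col !mul_scalar_mx.
    by rewrite !(mxE, big_ord1); ring.
  by rewrite ler_wpM2r ?dot_ge0.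
Qed.

End Norms.

(** * Growth of the flow of one subsystem in its Jordan coordinates *)

Section Flow.
Variable R : realType.

Lemma continuous_sum (T : topologicalType) (I : Type) (s : seq I) (f : I -> T -> R) (x : T) :
  (forall i, {for x, continuous (f i)}) ->
  {for x, continuous (fun u => \sum_(i <- s) f i u)}.
Proof.
move=> fc; elim: s => [|i s IH].
  rewrite (_ : (fun _ => _) = cst 0); first exact: cst_continuous.
  by apply/funext => u; rewrite big_nil.
rewrite (_ : (fun _ => _) = f i \+ (fun u => \sum_(j <- s) f j u)).
  exact: continuousD.
by apply/funext => u; rewrite big_cons.
Qed.

Lemma within_continuous_mulmx_coord m n (M : 'M[R]_(m, n)) (A : set R)
    (x : R -> 'cV[R]_n) i :
  {within A, continuous x} -> {within A, continuous (fun u => (M *m x u) i 0)}.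
Proof.
move=> xc; rewrite (_ : (fun _ => _) = fun u => \sum_j M i j * x u j 0); last first.
  by apply/funext => u; rewrite mxE.
move=> u; apply: (@continuous_sum (subspace A)) => j.
apply: (@continuousM _ (subspace A)); first exact: cst_continuous.
apply: (@continuous_comp (subspace A) _ _ x (fun N : 'cV[R]_n => N j 0)); first exact: xc.
exact: coord_continuous.
Qed.

Lemma is_derive_mulmx_coord m n (M : 'M[R]_(m, n)) (x : R -> 'cV[R]_n) s dx i :
  is_derive s (1 : R) x dx ->
  is_derive s (1 : R) (fun u => (M *m x u) i 0) ((M *m dx) i 0).
Proof.
case=> xd <-; have xij j : is_derive s (1 : R) (fun u => x u j 0) (('D_1 x s) j 0).
  rewrite derive_mx // mxE; apply/derivableP.
  by move/derivable_mxP: xd; apply.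
rewrite (_ : (fun _ => _) = \sum_j (M i j *: fun u => x u j 0)); last first.
  by rewrite fct_sumE; apply/funext => u; rewrite mxE.
by rewrite mxE; apply: is_derive_sum.
Qed.

(** With y = P^-1 x, the function e^(-2au) |y(u)|^2 has derivative 2 e^(-2au) (y^T D y - a |y|^2) <=
    0, so it does not increase on the interval. *)
Lemma flow_le d (A P D : 'M[R]_d) (a t0 t1 : R) (x : R -> 'cV[R]_d) :
  P \in unitmx -> A = P *m D *m invmx P ->
  (forall y : 'cV[R]_d, (y^T *m (D *m y)) 0 0 <= a * (y^T *m y) 0 0) ->
  {within `[t0, t1], continuous x} ->
  (forall s, t0 < s < t1 -> is_derive s (1 : R) x (A *m x s)) ->
  forall s, t0 <= s <= t1 ->
  euclid_norm (invmx P *m x s) <= expR (a * (s - t0)) * euclid_norm (invmx P *m x t0).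
Proof.
move=> uP AE Da xc xd s /andP[t0s st1].
pose y u := invmx P *m x u.
pose V := (fun u : R => expR (- (a *+ 2) * u)) * \sum_i (fun u => y u i 0) ^+ 2.
have VE u : V u = expR (- (a *+ 2) * u) * euclid_norm (y u) ^+ 2.
  rewrite /V /GRing.mul /= fct_sumE sqr_euclid_norm mxE; congr (_ * _).
  by apply: eq_bigr => i _; rewrite mxE.
have Vd u : t0 < u < t1 -> is_derive u (1 : R) V
    ((expR (- (a *+ 2) * u) *+ 2) *
       (((y u)^T *m (D *m y u)) 0 0 - a * ((y u)^T *m y u) 0 0)).
  move=> /xd xdu.
  have yd i := is_derive_mulmx_coord (invmx P) i xdu.
  have yE : invmx P *m (A *m x u) = D *m y u by rewrite AE /y !mulmxA mulVmx ?mul1mx.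
  rewrite yE in yd.
  have Ed : is_derive u (1 : R) (fun u => expR (- (a *+ 2) * u))
      (expR (- (a *+ 2) * u) * - (a *+ 2)).
    apply: (@is_derive1_comp _ expR (fun u => - (a *+ 2) * u)).
    rewrite -[X in is_derive _ _ _ X]mulr1.
    exact: (@is_deriveZ _ _ _ id).
  have Sd : is_derive u (1 : R) (\sum_i (fun u => y u i 0) ^+ 2)
      (\sum_i (2%:R * y u i 0 ^+ 1) *: (D *m y u) i 0).
    apply: is_derive_sum => i; exact: is_deriveX.
  apply: is_derive_eq (is_deriveM Ed Sd) _.
  rewrite /GRing.scale /= fct_sumE; set E := expR _.
  have -> : \sum_i ((fun u => y u i 0) ^+ 2) u = ((y u)^T *m y u) 0 0.
    by rewrite mxE; apply: eq_bigr => i _; rewrite mxE.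
  have -> : \sum_i 2 * y u i 0 ^+ 1 * (D *m y u) i 0 = 2 * ((y u)^T *m (D *m y u)) 0 0.
    by rewrite [in RHS]mxE mulr_sumr; apply: eq_bigr => i _; rewrite [_^T _ _]mxE expr1 mulrA.
  ring.
have V_le : V s <= V t0.
  have st : s \in `[t0, t1] by rewrite in_itv /= t0s st1.
  have t0t : t0 \in `[t0, t1] by rewrite in_itv /= lexx (le_trans t0s).
  apply: (@ler0_derive1_le_cc _ V t0 t1) t0s => //.
  - by move=> u; rewrite in_itv /= => /Vd[].
  - move=> u; rewrite in_itv /= => /Vd[_]; rewrite derive1E => ->.
    by rewrite mulr_ge0_le0 ?mulrn_wge0 ?expR_ge0 // subr_le0.
  - rewrite (_ : V = (fun u => expR (- (a *+ 2) * u)) \* fun u => \sum_i y u i 0 * y u i 0).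
      move=> u; apply: (@continuousM _ (subspace _)).
        apply: continuous_subspaceT => v; apply: continuous_comp; last exact: continuous_expR.
        exact: mulrl_continuous.
      apply: (@continuous_sum (subspace _)) => i.
      by apply: (@continuousM _ (subspace _)); exact: within_continuous_mulmx_coord.
    by rewrite /V fct_sumE; apply/funext => u.
rewrite -(@ler_pXn2r _ 2) ?nnegrE ?mulr_ge0 ?expR_ge0 ?euclid_norm_ge0 //.
rewrite exprMn -expRM_natl; move: V_le; rewrite !VE.
rewrite -/(y s) -/(y t0); move: (_ ^+ 2) (_ ^+ 2) => p q.
(* Multiplying by e^(-2as) turns the two sides into V(s) and V(t0). *)
move=> h; rewrite -(ler_pM2l (expR_gt0 (- (a *+ 2) * s))); apply: le_trans h _.
rewrite [leRHS]mulrA -expRD le_eqVlt; apply/orP; left; apply/eqP.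
by congr (expR _ * _); ring.
Qed.

End Flow.

(** * Maxima with default 0, edges of a loop, elementary inequalities *)

Section MaxOr0.
Variable R : realType.
Implicit Types (x : R) (l : seq R).

Lemma le_max_or0 l x : x \in l -> x <= max_or0 l.
Proof.
case: l => [//|y l] /=; rewrite inE => /orP[/eqP ->|xl].
  exact: bigmax_ge_id.
exact: (@le_bigmax_seq _ _ _ _ _ _ predT id xl isT).
Qed.

(** The default 0 on the empty list respects both signs, which covers loops without stable or
    without unstable edges. *)
Lemma max_or0_le0 l : (forall x, x \in l -> x <= 0) -> max_or0 l <= 0.
Proof.
case: l => [//|y l] l0 /=; rewrite big_seq; apply: bigmax_le => [|z zl].
  by apply: l0; rewrite mem_head.
by apply: l0; rewrite inE zl orbT.
Qed.

Lemma max_or0_ge0 l : (forall x, x \in l -> 0 <= x) -> 0 <= max_or0 l.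
Proof.
case: l => [//|y l] l0.
by apply: le_trans (l0 y _) (le_max_or0 _); rewrite mem_head.
Qed.

End MaxOr0.

Section LoopEdges.
Variable k : nat.
Implicit Type c : seq 'I_k.

Lemma loop_edges_same c c' : uniq c' -> same_loop c c' -> loop_edges c = loop_edges c'.
Proof.
move=> uc [n ->]; apply/setP => e; rewrite /loop_edges.
apply/imsetP/imsetP => -[u uc' ->]; exists u.
- by rewrite mem_rot in uc'.
- by rewrite next_rot.
- by rewrite mem_rot.
- by rewrite next_rot.
Qed.

Lemma prod_loop_edges (R : comNzRingType) (F : 'I_k * 'I_k -> R) c : uniq c ->
  \prod_(e in loop_edges c) F e = \prod_(u <- c) F (u, next c u).
Proof. by move=> uc; rewrite big_imset ?big_uniq //= => u v _ _ []. Qed.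

End LoopEdges.

Lemma bernoulli_ineq (R : realDomainType) (x : R) n :
  0 <= x <= 1 -> 1 - n%:R * x <= (1 - x) ^+ n.
Proof.
move=> /andP[x0 x1]; elim: n => [|n IH]; first by rewrite mul0r subr0.
rewrite exprS; apply: le_trans (ler_wpM2l _ IH); last by rewrite subr_ge0.
have : 0 <= n%:R * x ^+ 2 by rewrite mulr_ge0 // sqr_ge0.
rewrite -natr1; nra.
Qed.

Lemma prod_scale (R : comNzRingType) (I : Type) (s : seq I) (a : R) (F : I -> R) :
  \prod_(i <- s) (a * F i) = a ^+ size s * \prod_(i <- s) F i.
Proof.
elim: s => [|i s IH]; first by rewrite !big_nil mulr1.
by rewrite !big_cons IH /= exprS; ring.
Qed.

Lemma le_sum_mem (R : realDomainType) (I : eqType) (s : seq I) (Q : pred I) (F : I -> R) i :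
  (forall j, 0 <= F j) -> i \in s -> Q i -> F i <= \sum_(j <- s | Q j) F j.
Proof.
move=> F0 is_ Qi; rewrite (big_rem i) //= Qi lerDl; exact: sumr_ge0.
Qed.

Lemma le_sum_fin (R : realDomainType) (I : finType) (F : I -> R) i :
  (forall j, 0 <= F j) -> F i <= \sum_j F j.
Proof. by move=> F0; apply: le_sum_mem => //; rewrite mem_index_enum. Qed.

(** * Elementary properties of switching times *)

Section SwitchingTimes.
Variables (R : realType) (k : nat) (sigma : R -> 'I_k) (t : nat -> R).
Hypothesis ht : switching_times sigma t.

Lemma switching_times_le m n : (m <= n)%N -> t m <= t n.
Proof.
case: ht => _ tS _ _ _; apply: (homo_leq (@lexx _ _) (@le_trans _ _)) => i.
exact/ltW/tS.
Qed.

Lemma switching_times_ge0 n : 0 <= t n.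
Proof. by case: (ht) => <- _ _ _ _; exact: switching_times_le. Qed.

Lemma dwell_ge0 j : 0 <= dwell t j.
Proof. by rewrite subr_ge0 switching_times_le // leq_pred. Qed.

Lemma symbol_switch j : symbol sigma t j.+2 != symbol sigma t j.+1.
Proof. by case: ht => _ _ _ _ /(_ j) /eqP. Qed.

Lemma switching_interval u : 0 <= u -> exists n, t n <= u < t n.+1.
Proof.
move=> u0; case: (ht) => t0 _ tinf _ _.
have ex : exists n, u < t n.
  by have /cvgryPgt/(_ u)[N _ /(_ N (leqnn N))] := tinf; exists N.
case: (ex_minnP ex) => -[|n] un min; first by move: un; rewrite t0 ltNge u0.
by exists n; rewrite un andbT leNgt; apply/negP => /min; rewrite ltnn.
Qed.

End SwitchingTimes.

(** * The gain of one loop *)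

Section LoopEstimate.
Variables (R : realType) (d k r p : nat) (G : rel 'I_k) (s : 'I_p -> seq 'I_k).
Hypothesis hs : enumerates_simple_loops G s.
Variables (lambda mu : 'I_k -> R) (P : 'I_k -> 'M[R]_d).
Hypothesis lambda_ge0 : forall i, is_stable r i -> - lambda i <= 0.
Hypothesis mu_ge0 : forall i, ~~ is_stable r i -> 0 <= mu i.
Variables (tau eta : 'I_p -> R) (sigma : R -> 'I_k) (t : nat -> R).
Hypothesis ht : switching_times sigma t.
Hypothesis hadm : admissible G sigma t.
Hypothesis hclass : dwell_class r s tau eta sigma t.

Definition growth_rate (v : 'I_k) : R := if is_stable r v then - lambda v else mu v.

(** The exponential accounts for the flow during the dwell time, the norm for the change of Jordan
    coordinates at the switch that follows. *)
Definition edge_gain (j : nat) : R :=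
  let w := symbol sigma t in
  spectral_norm (invmx (P (w j.+1)) *m P (w j)) * expR (growth_rate (w j) * dwell t j).

Let w := symbol sigma t.
Let L := closed_loop w.

(** A closed loop is simple, hence one of the [s i] up to rotation, and it occurs in a standard
    decomposition, so the dwell bounds of [s i] apply to it. *)
Lemma closed_loop_index m : L m != [::] ->
  exists i, [/\ loop_edges [seq w j | j <- L m] = loop_edges (s i),
    tau i <= \sum_(j <- L m | is_stable r (w j)) dwell t j &
    \sum_(j <- L m | ~~ is_stable r (w j)) dwell t j <= eta i].
Proof.
move=> nL.
have [i [si _]] := hs.2 _ (closed_loop_simple (fun j => hadm (ltn0Sn j)) nL).
exists i; have [] := hclass (ltn0Sn _) (decomposition_closed_loop (symbol_switch ht) nL) si.
split=> //; apply: loop_edges_same si.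
by have /and3P[] := hs.1 i.
Qed.

(** The norms multiply to [rho] exactly. In the exponent each rate is replaced by the worst one of
    its kind on the loop, then the total times by [tau i] and [eta i]. *)
Lemma loop_gain_le m : L m != [::] -> exists i,
  \prod_(j <- L m) edge_gain j <=
  rho P (s i) * expR (- lambda_loop r G lambda (s i) * tau i + mu_loop r G mu (s i) * eta i).
Proof.
move=> nL; have [i [Ei tau_le le_eta]] := closed_loop_index nL; exists i.
have uL := uniq_closed_loop w m.
rewrite big_split /= -expR_sum.
have -> : \prod_(j <- L m) spectral_norm (invmx (P (w j.+1)) *m P (w j)) = rho P (s i).
  rewrite /rho -Ei prod_loop_edges // big_map; apply: eq_big_seq => j jL.
  by rewrite next_closed_loop.
apply: ler_wpM2l; first by apply: prodr_ge0 => e _; exact: spectral_norm_ge0.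
rewrite ler_expR (bigID (fun j => is_stable r (w j))) /=.
have edge j : j \in L m -> (w j, w j.+1) \in loop_edges (s i) /\ G (w j) (w j.+1).
  move=> jL; split.
    rewrite -Ei -(next_closed_loop jL); apply/imsetP.
    by exists (w j) => //; apply: map_f.
  by have := closed_loop_gt0 jL; case: j {jL} => // j _; exact: hadm.
apply: lerD.
- apply: (@le_trans _ _ (- lambda_loop r G lambda (s i) *
      \sum_(j <- L m | is_stable r (w j)) dwell t j)).
    rewrite mulr_sumr big_seq_cond [leRHS]big_seq_cond; apply: ler_sum => j /andP[jL st].
    rewrite ler_wpM2r ?(dwell_ge0 ht) // /growth_rate st opprK.
    apply: le_max_or0; have [e1 e2] := edge j jL.
    apply/fintype.imageP; exists (w j, w j.+1) => //.
    by rewrite inE e1 inE /= /stable_subgraph e2.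
  (* The worst stable rate is at most 0, so the lower bound on the stable time bounds the exponent
     from above. *)
  apply: ler_wnM2l tau_le; rewrite opprK; apply: max_or0_le0 => x /fintype.imageP[e].
  by rewrite !inE => /and3P[_ _ st] ->; exact: lambda_ge0.
- apply: (@le_trans _ _ (mu_loop r G mu (s i) *
      \sum_(j <- L m | ~~ is_stable r (w j)) dwell t j)).
    rewrite mulr_sumr big_seq_cond [leRHS]big_seq_cond; apply: ler_sum => j /andP[jL st].
    rewrite ler_wpM2r ?(dwell_ge0 ht) // /growth_rate (negPf st).
    apply: le_max_or0; have [e1 e2] := edge j jL.
    apply/fintype.imageP; exists (w j, w j.+1) => //.
    by rewrite inE e1 inE /= /unstable_subgraph e2.
  apply: ler_wpM2l le_eta; apply: max_or0_ge0 => x /fintype.imageP[e].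
  by rewrite !inE => /and3P[_ _ st] ->; exact: mu_ge0.
Qed.

(* Only finitely many edges never enter a loop, and the dwell time on any other
   unstable edge is part of a loop. *)
Lemma unstable_dwell_bounded : (forall i, 0 <= eta i) ->
  exists2 M, 0 <= M & forall j, ~~ is_stable r (w j) -> dwell t j <= M.
Proof.
move=> eta0; have [N closedN] := eventually_closed w.
have s0 : 0 <= \sum_i eta i by exact: sumr_ge0.
(* [t N] serves the edges up to index N, whose dwell times fit in [0, t N]; the sum of the [eta i]
   serves the later ones, each lying in some loop. *)
exists (\sum_i eta i + t N) => [|j uj]; first by rewrite addr_ge0 ?(switching_times_ge0 ht).
case: (leqP j N) => [jN|/closedN[m jL]].
  apply: (@le_trans _ _ (t N)); last by rewrite lerDr.
  rewrite lerBlDr; apply: le_trans (switching_times_le ht jN) _.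
  by rewrite lerDl (switching_times_ge0 ht).
have nL : L m != [::] by apply/eqP => e; move: jL; rewrite (e : closed_loop w m = _).
have [i [_ _ le_eta]] := closed_loop_index nL.
apply: (@le_trans _ _ (eta i)).
  by apply: le_trans le_eta; apply: le_sum_mem => // l; exact: dwell_ge0 ht _.
apply: (@le_trans _ _ (\sum_i eta i)); first exact: le_sum_fin.
by rewrite lerDl (switching_times_ge0 ht).
Qed.

End LoopEstimate.

(** * Geometric decay of the products of gains *)

Section GainProducts.
Variables (R : realType) (k : nat) (w : nat -> 'I_k).

(* Each loop has at most k edges, so the gain of a loop can be shared out among
   its edges at the price of a worse rate c. *)
Lemma prod_gain_le (g : nat -> R) (B Q : R) :
  (forall j, 0 <= g j <= B) -> Q < 1 ->
  (forall m, closed_loop w m != [::] -> \prod_(j <- closed_loop w m) g j <= Q) ->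
  exists K c, [/\ 0 <= K, 0 < c < 1 &
    forall n, \prod_(1 <= j < n.+1) g j <= K * c ^+ n].
Proof.
move=> gB Q1 loopQ.
have g0 j : 0 <= g j by have /andP[] := gB j.
have B0 : 0 <= B by have /andP[/le_trans] := gB 0%N; apply.
(* Nothing prevents Q from being negative, while Bernoulli's inequality below needs x <= 1. *)
pose Q' := Num.max 0 Q.
have Q'0 : 0 <= Q' by rewrite le_max lexx.
have Q'1 : Q' < 1 by rewrite gt_max ltr01 Q1.
(* Chosen so that (1 - x)^k >= 1 - k x >= Q'; the denominator k+2 also gives x <= 1/2, hence c >
   0. *)
pose x := (1 - Q') / k.+2%:R.
have xk : k.+2%:R * x = 1 - Q' by rewrite mulrC divfK // pnatr_eq0.
have x0 : 0 < x by rewrite divr_gt0 ?ltr0n // subr_gt0.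
have kx0 : 0 <= k%:R * x by rewrite mulr_ge0 // ltW.
rewrite -addn2 natrD in xk.
pose c := 1 - x; have c0 : 0 < c by rewrite /c; lra.
have c1 : c < 1 by rewrite /c; lra.
have cV : 0 <= c^-1 by rewrite invr_ge0 ltW.
have Qc : Q' <= c ^+ k.
  by apply: le_trans (bernoulli_ineq k (x := x) _); [lra | apply/andP; split; lra].
pose K := 1 + c^-1 * B.
have K1 : 1 <= K by rewrite lerDl mulr_ge0.
exists (K ^+ k), c; split; [by rewrite exprn_ge0 // (le_trans ler01) | by rewrite c0 |].
move=> n.
have hK j : 0 <= c^-1 * g j <= K.
  rewrite mulr_ge0 //= /K; apply: (@le_trans _ _ (c^-1 * B)); last by rewrite lerDr.
  by rewrite ler_wpM2l //; have /andP[] := gB j.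
(* Dividing every gain by c keeps loop products at most 1: a loop has at most k edges, so c to its
   length is at least c^k >= Q'. *)
have loop1 m : \prod_(j <- closed_loop w m) (c^-1 * g j) <= 1.
  rewrite prod_scale exprVn ler_pdivrMl ?exprn_gt0 // mulr1.
  have [->|nL] := eqVneq (closed_loop w m) [::]; first by rewrite big_nil.
  apply: le_trans (loopQ m nL) _; apply: (@le_trans _ _ Q').
    by rewrite le_max lexx orbT.
  apply: le_trans Qc _; apply: ler_wiXn2l; [exact: ltW | exact: ltW |].
  rewrite -(size_map w) -(card_uniqP (uniq_closed_loop w m)) -[leqRHS]card_ord.
  exact: max_card.
have := prod_le_expr K1 hK loop1 n; rewrite prod_scale size_iota subn1 /= exprVn.
by rewrite ler_pdivrMl ?exprn_gt0 // [leRHS]mulrC.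
Qed.

End GainProducts.

(** A time u >= t_N lies in an interval of index n >= N, where the bound C c^n is at most C c^N. *)
Lemma geometric_tail_cvg0 (R : realType) (k : nat) (sigma : R -> 'I_k) (t : nat -> R)
    (f : R -> R) (C c : R) :
  switching_times sigma t -> 0 <= C -> 0 < c < 1 -> (forall u, 0 <= f u) ->
  (forall n u, t n <= u < t n.+1 -> f u <= C * c ^+ n) ->
  f u @[u --> +oo] --> (0 : R).
Proof.
move=> ht C0 /andP[c0 c1] f0 fC.
have lim0 : (fun n => C * c ^+ n) @ \oo --> (0 : R).
  rewrite -(mulr0 C); apply: cvgM; first exact: cvg_cst.
  by apply: cvg_expr; rewrite ger0_norm // ltW.
apply/cvgrPdist_le => e e0.
have [N _ /(_ N (leqnn N)) NC] := (cvgrPdist_le _ _).1 lim0 e e0.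
rewrite /= sub0r normrN ger0_norm ?mulr_ge0 ?exprn_ge0 ?(ltW c0) // in NC.
near=> u; rewrite sub0r normrN ger0_norm //.
have tu : t N <= u by near: u; apply: nbhs_pinfty_ge; rewrite num_real.
have [n tn] := switching_interval ht (le_trans (switching_times_ge0 ht N) tu).
apply: le_trans (fC n u tn) _; apply: le_trans NC.
rewrite ler_wpM2l // ler_wiXn2l ?(ltW c0) ?(ltW c1) //.
rewrite -ltnS ltnNge; apply/negP => /(switching_times_le ht) le.
by have /andP[_] := tn; rewrite ltNge (le_trans le tu).
Unshelve. all: by end_near. Qed.

(** * Bounding a solution by the product of gains *)

Section SolutionBound.
Variables (R : realType) (d k r : nat) (A P D : 'I_k -> 'M[R]_d) (lambda mu : 'I_k -> R).
Variables (sigma : R -> 'I_k) (t : nat -> R) (x : R -> 'cV[R]_d).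
Hypothesis ht : switching_times sigma t.
Hypothesis hP : forall j, P j \in unitmx.
Hypothesis hA : forall j, A j = P j *m D j *m invmx (P j).
Hypothesis hD : forall j (y : 'cV[R]_d),
  (y^T *m (D j *m y)) 0 0 <= growth_rate r lambda mu j * (y^T *m y) 0 0.
Hypothesis hx : solution A sigma x.

Let w := symbol sigma t.
Let a := growth_rate r lambda mu.

Lemma solution_interval_le n u : t n <= u <= t n.+1 ->
  euclid_norm (invmx (P (w n.+1)) *m x u) <=
  expR (a (w n.+1) * (u - t n)) * euclid_norm (invmx (P (w n.+1)) *m x (t n)).
Proof.
have [xc xd] := hx; have tn0 := switching_times_ge0 ht n.
apply: flow_le (hP _) (hA _) (hD _) _ _ u.
  apply: continuous_subspaceW xc => v /=; rewrite !in_itv /= andbT => /andP[tv _].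
  exact: le_trans tv.
case: (ht) => _ _ _ const _ v /andP[tv vt].
have sv : sigma v = w n.+1 by apply: const; rewrite ltW.
(* Strictly between two switching times the signal is locally constant, so the differential equation
   holds there. *)
rewrite -sv; apply: xd; first exact: le_lt_trans tv.
near=> z; rewrite sv; apply: const; apply/andP; split.
  by apply: ltW; near: z; exact: lt_nbhsr.
by near: z; exact: lt_nbhsl.
Unshelve. all: by end_near. Qed.

(** The norm is always taken in the coordinates of the subsystem about to run. Inserting
    [P (w n.+1)] and its inverse at a switch produces exactly the matrix of [edge_gain]. *)
Lemma solution_switching_le n :
  euclid_norm (invmx (P (w n.+1)) *m x (t n)) <=
  (\prod_(1 <= j < n.+1) edge_gain r lambda mu P sigma t j) *
  euclid_norm (invmx (P (w 1)) *m x (t 0%N)).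
Proof.
elim: n => [|n IH]; first by rewrite big_geq // mul1r.
rewrite big_nat_recr //= mulrAC mulrC.
have -> : invmx (P (w n.+2)) *m x (t n.+1) =
    (invmx (P (w n.+2)) *m P (w n.+1)) *m (invmx (P (w n.+1)) *m x (t n.+1)).
  by rewrite mulmxA -[_ *m P _ *m _]mulmxA mulmxV // mulmx1.
apply: le_trans (euclid_norm_mulmx _ _) _.
rewrite [edge_gain _ _ _ _ _ _ n.+1]/edge_gain -mulrA.
apply: ler_wpM2l; first exact: spectral_norm_ge0.
have tn : t n <= t n.+1 <= t n.+1 by rewrite lexx (switching_times_le ht).
apply: le_trans (solution_interval_le tn) _.
by apply: ler_wpM2l IH; exact: expR_ge0.
Qed.

Lemma solution_le n u : t n <= u <= t n.+1 ->
  euclid_norm (x u) <= spectral_norm (P (w n.+1)) *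
    (expR (a (w n.+1) * (u - t n)) *
      ((\prod_(1 <= j < n.+1) edge_gain r lambda mu P sigma t j) *
        euclid_norm (invmx (P (w 1)) *m x (t 0%N)))).
Proof.
move=> tu; rewrite -{1}(mulKVmx (hP (w n.+1)) (x u)).
apply: le_trans (euclid_norm_mulmx _ _) _.
apply: ler_wpM2l; first exact: spectral_norm_ge0.
apply: le_trans (solution_interval_le tu) _.
by apply: ler_wpM2l (solution_switching_le n); exact: expR_ge0.
Qed.

End SolutionBound.

(** * Uniform constants and conclusion *)

Unset Implicit Arguments.
Set Strict Implicit.

Theorem proposition4p9 (R : realType) (d k r p : nat)
    (hr : (1 <= r < k)%N) (hp : (1 <= p)%N)
    (G : rel 'I_k) (s : 'I_p -> seq 'I_k)
    (hs : enumerates_simple_loops G s)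
    (hGus : forall i : 'I_k, ~~ is_stable r i ->
       exists2 j : 'I_k, is_stable r j & connect G i j)
    (hGsu : forall i : 'I_k, is_stable r i ->
       exists2 j : 'I_k, ~~ is_stable r j & connect G i j)
    (A : 'I_k -> 'M[R]_d)
    (hdiag : forall i, diagonalizable (complex_mx (A i)))
    (hstable : forall i, is_stable r i -> stable_mx (A i))
    (hunstable : forall i, ~~ is_stable r i -> unstable_mx (A i))
    (lambda mu : 'I_k -> R)
    (hlambda : forall i, is_stable r i ->
       - lambda i < 0 /\ max_real_part (A i) (- lambda i))
    (hmu : forall j, ~~ is_stable r j ->
       0 < mu j /\ max_real_part (A j) (mu j))
    (P D : 'I_k -> 'M[R]_d)
    (hPD : forall j, [/\ P j \in unitmx,
       A j = P j *m D j *m invmx (P j) &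
       real_jordan_basis (A j) (P j) (D j)])
    (tau eta : 'I_p -> R)
    (htau : forall i, 0 < tau i) (heta : forall i, 0 < eta i)
    (sigma : R -> 'I_k) (t : nat -> R)
    (ht : switching_times sigma t)
    (hadm : admissible G sigma t)
    (hboth : forall T : R, 0 < T ->
       (exists2 u, T < u & is_stable r (sigma u)) /\
       (exists2 u, T < u & ~~ is_stable r (sigma u)))
    (hclass : dwell_class r s tau eta sigma t)
    (hineq : forall i : 'I_p,
       ln (rho P (s i)) - lambda_loop r G lambda (s i) * tau i
         + mu_loop r G mu (s i) * eta i < 0) :
  asymptotically_stable A sigma.
Proof.
move=> x0 x _ hx.
have hP j : P j \in unitmx by case: (hPD j).
have hA j : A j = P j *m D j *m invmx (P j) by case: (hPD j).
pose a := growth_rate r lambda mu.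
have hD j (y : 'cV[R]_d) : (y^T *m (D j *m y)) 0 0 <= a j * (y^T *m y) 0 0.
  have [_ _ JB] := hPD j; apply: jordan_form_le JB _ y => z ez; rewrite /a /growth_rate.
  by case: ifPn => [/hlambda|/hmu] [_ [_]]; apply.
have lambda_le0 i : is_stable r i -> - lambda i <= 0 by move=> /hlambda[/ltW].
have mu_ge0 i : ~~ is_stable r i -> 0 <= mu i by move=> /hmu[/ltW].
have [M M0 dwellM] := unstable_dwell_bounded hs ht hadm hclass (fun i => ltW (heta i)).
(* One bound for all subsystems: the exponent is nonpositive in a stable one, and at most [mu v * M]
   in an unstable one. *)
pose E := expR (\sum_v `|mu v| * M).
have rate_le v u : (~~ is_stable r v -> u <= M) -> 0 <= u -> expR (a v * u) <= E.
  move=> uM u0; rewrite ler_expR; apply: (@le_trans _ _ (`|mu v| * M)); last first.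
    by apply: (le_sum_fin (F := fun v => `|mu v| * M)) => ?; rewrite mulr_ge0.
  rewrite /a /growth_rate; case: ifPn => st.
    by apply: (@le_trans _ _ 0); rewrite ?mulr_ge0 // mulr_le0_ge0 // lambda_le0.
  rewrite ger0_norm ?mu_ge0 // ler_wpM2l ?mu_ge0 //; exact: uM.
pose w := symbol sigma t.
pose g := edge_gain r lambda mu P sigma t.
pose S := \sum_u \sum_v spectral_norm (invmx (P v) *m P u).
have S0 u v : 0 <= spectral_norm (invmx (P v) *m P u) by exact: spectral_norm_ge0.
have gB j : 0 <= g j <= S * E.
  rewrite mulr_ge0 ?expR_ge0 ?spectral_norm_ge0 //=.
  apply: ler_pM; rewrite ?expR_ge0 ?spectral_norm_ge0 //; last first.
    by apply: rate_le; [exact: dwellM | exact: dwell_ge0 ht j].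
  apply: (@le_trans _ _ (\sum_v spectral_norm (invmx (P v) *m P (w j)))).
    exact: (le_sum_fin (F := fun v => spectral_norm (invmx (P v) *m P (w j)))).
  apply: (le_sum_fin (F := fun u => \sum_v spectral_norm (invmx (P v) *m P u))) => u.
  exact: sumr_ge0.
pose q i := rho P (s i) *
  expR (- lambda_loop r G lambda (s i) * tau i + mu_loop r G mu (s i) * eta i).
have q1 i : q i < 1.
  (* At a nonpositive argument [lnK] does not apply, but then [q i <= 0] directly; otherwise [q i]
     is the exponential of the left side of [hineq]. *)
  have [rho0|rho0] := leP (rho P (s i)) 0.
    by apply: (@le_lt_trans _ _ 0); rewrite ?ltr01 // mulr_le0_ge0 ?expR_ge0.
  rewrite /q -{1}(lnK rho0) -expRD -expR0 ltr_expR.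
  have := hineq i; lra.
(* A common Q for all loops: the maximum of finitely many numbers [q i] below 1. *)
have [] := @prod_gain_le _ _ w g (S * E) (\big[Num.max/0]_i q i) gB.
- exact: bigmax_lt ltr01 (fun i _ => q1 i).
- move=> m /(loop_gain_le hs P lambda_le0 mu_ge0 ht hadm hclass)[i qi].
  exact: le_trans qi (le_bigmax _ _ _).
move=> K [c [K0 c01 gK]].
pose T := \sum_v spectral_norm (P v).
pose N0 := euclid_norm (invmx (P (w 1)) *m x (t 0%N)).
have T0 : 0 <= T by apply: sumr_ge0 => v _; exact: spectral_norm_ge0.
apply: (@geometric_tail_cvg0 _ _ sigma t _ (T * (E * (K * N0))) c) => //.
- by rewrite !mulr_ge0 ?expR_ge0 ?euclid_norm_ge0.
- by move=> u; exact: euclid_norm_ge0.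
move=> n u /andP[tu ut].
have tut : t n <= u <= t n.+1 by rewrite tu ltW.
apply: le_trans (solution_le ht hP hA hD hx tut) _.
rewrite -!mulrA; apply: ler_pM; rewrite ?spectral_norm_ge0 //.
- by rewrite !mulr_ge0 ?expR_ge0 ?euclid_norm_ge0 // prodr_ge0 // => j _; have /andP[] := gB j.
- apply: (le_sum_fin (F := fun v => spectral_norm (P v))) => v; exact: spectral_norm_ge0.
apply: ler_pM; rewrite ?expR_ge0 //.
- by rewrite mulr_ge0 ?euclid_norm_ge0 // prodr_ge0 // => j _; have /andP[] := gB j.
(* The time elapsed since t_n is at most the full dwell time of index n+1, so the bound M still
   covers it. *)
- apply: rate_le; last by rewrite subr_ge0.
  move=> /dwellM; apply: le_trans; rewrite /dwell /= lerB // ltW //.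
rewrite [N0 * _]mulrC mulrA; apply: ler_wpM2r (gK n); exact: euclid_norm_ge0.
Qed.
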